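(* Let $F$ be a field of characteristic not two and let $E$ be a finite-dimensional vector space over $F$ with an arbitrary symmetric bilinear form $(U,V)\mapsto U\cdot V$. Suppose that $u,v,w,z$ are coplanar projective points of $E$ with projective spreads $R_u=S(zv,zw)$, $R_v=S(zu,zw)$ and $R_w=S(zu,zv)$ (all three assumed to be defined; in particular $z$ is non-null and distinct from $u,v,w$). Then $$(R_u+R_v+R_w)^2=2\left(R_u^2+R_v^2+R_w^2\right)+4R_uR_vR_w.$$
   Context: A projective point $u=[U]$ is a one-dimensional subspace of $E$, spanned by a non-zero vector $U$; it is null if $U\cdot U=0$, and non-null otherwise. For distinct projective points $u,v$, $uv$ denotes the projective line (two-dimensional subspace) they span. Projective points are coplanar when they are all contained in a single three-dimensional subspace of $E$ (a projective plane). The projective spread between the projective lines $wu$ and $wv$, where $u=[U]$, $v=[V]$, $w=[W]$ with $w$ non-null, is, putting $U'=U-\frac{U\cdot W}{W\cdot W}W$ and $V'=V-\frac{V\cdot W}{W\cdot W}W$, $$S(wu,wv)=1-\frac{(U'\cdot V')^2}{(U'\cdot U')(V'\cdot V')},$$ and it is undefined if one of the denominators is zero. Equivalently, with $a_X=X\cdot X$ and $b_{XY}=X\cdot Y$, $$S(wu,wv)=1-\frac{(a_Wb_{UV}-b_{UW}b_{VW})^2}{(a_Ua_W-b_{UW}^2)(a_Va_W-b_{VW}^2)}.$$ The bilinear form is not assumed non-degenerate. *)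

(* Defs.v *)
From mathcomp Require Import all_boot all_algebra.
From mathcomp Require Import ring.

Set Implicit Arguments.
Unset Strict Implicit.
Unset Printing Implicit Defensive.

Import GRing.Theory.
Local Open Scope ring_scope.

Section ProjectiveSpread.

Variables (F : fieldType) (E : vectType F).
Implicit Types (B : {symmetric E}) (U V W : E) (u v w : {vspace E}).

Definition proj_point u : Prop := \dim u = 1%N.

Definition coplanar (s : seq {vspace E}) : Prop :=
  exists2 P : {vspace E}, \dim P = 3%N & {in s, forall u, (u <= P)%VS}.

Definition perp_part B W U : E := U - (B U W / B W W) *: W.

Definition vec_spread B W U V : option F :=
  let U' := perp_part B W U in
  let V' := perp_part B W V in
  if [&& B W W != 0, B U' U' != 0 & B V' V' != 0]
  then Some (1 - B U' V' ^+ 2 / (B U' U' * B V' V'))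
  else None.

(* S(wu, wv), None when undefined. It is computed from the spanning vectors
   chosen by vpick; spread_vline shows that the choice is irrelevant. *)
Definition spread B w u v : option F :=
  vec_spread B (vpick w) (vpick u) (vpick v).

Lemma form_scale B (a b : F) U V : B (a *: U) (b *: V) = a * b * B U V.
Proof. by rewrite linearZl_LR linearZr_LR /=; ring. Qed.

Lemma perp_partZ B W U (c a : F) :
  c != 0 -> perp_part B (c *: W) (a *: U) = a *: perp_part B W U.
Proof.
move=> c0; rewrite /perp_part scalerBr !scalerA !form_scale.
congr (_ - _ *: _); have [->|W0] := eqVneq (B W W) 0.
  by rewrite mulr0 invr0 !mulr0 mul0r.
by field; rewrite c0 W0.
Qed.

Lemma vec_spreadZ B W U V (c a b : F) : c != 0 -> a != 0 -> b != 0 ->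
  vec_spread B (c *: W) (a *: U) (b *: V) = vec_spread B W U V.
Proof.
move=> c0 a0 b0; rewrite /vec_spread !perp_partZ // !form_scale.
rewrite !mulf_eq0 (negPf a0) (negPf b0) (negPf c0) /=.
case: ifP => // /and3P[_ U0 V0]; congr Some.
by field; rewrite a0 b0 U0 V0.
Qed.

Lemma vpick_vline U : U != 0 -> exists2 a : F, a != 0 & vpick <[U]> = a *: U.
Proof.
move=> U0; have /vlineP[a eqa] := memv_pick <[U]>.
exists a => //; apply: contraNneq U0 => a0.
by move/eqP: eqa; rewrite a0 scale0r vpick0 -memv0 -subv0 => /subvP; apply;
   apply: memv_line.
Qed.

Lemma spread_vline B W U V : W != 0 -> U != 0 -> V != 0 ->
  spread B <[W]> <[U]> <[V]> = vec_spread B W U V.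
Proof.
move=> /vpick_vline[c c0 eW] /vpick_vline[a a0 eU] /vpick_vline[b b0 eV].
by rewrite /spread eW eU eV vec_spreadZ.
Qed.

End ProjectiveSpread.

(* Main.v *)
Require Import Defs.
From mathcomp Require Import all_boot all_algebra.
From mathcomp Require Import ring.

Set Implicit Arguments.
Unset Strict Implicit.
Unset Printing Implicit Defensive.

Import GRing.Theory.
Local Open Scope ring_scope.

(** Subtracting from each vector of a three-dimensional space its component
    along the non-null vector [Z] leaves vectors in a space of dimension two:
    they are orthogonal to [Z], which is not orthogonal to itself
    ([size_free_perp_part]).  Hence the projections [U'], [V'], [W'] of
    vectors spanning the points u, v, w are linearly dependent, and their Gram
    determinant vanishes ([gram_det_eq0]), whether or not the form is
    degenerate.

    Let [a], [b], [c] be the diagonal entries of the Gram matrix, [x], [y],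
    [t] its off-diagonal ones, and [Cu = 1 - Ru], [Cv = 1 - Rv],
    [Cw = 1 - Rw] the squared cosines [x ^+ 2 / (b * c)],
    [y ^+ 2 / (a * c)], [t ^+ 2 / (a * b)].  Dividing the determinant by
    [a * b * c] gives
      [Cu + Cv + Cw - 1 = 2 * x * y * t / (a * b * c)],
    and squaring the right hand side gives [4 * Cu * Cv * Cw].  Rewritten in
    [Ru], [Rv], [Rw], the equation
      [(Cu + Cv + Cw - 1) ^+ 2 = 4 * Cu * Cv * Cw]
    is the claimed one. *)

Lemma sym_formC (F : fieldType) (E : vectType F) (B : {symmetric E}) X Y :
  B X Y = B Y X.
Proof. by rewrite hermC expr0 mul1r. Qed.

Lemma perp_part_orth (F : fieldType) (E : vectType F) (B : {symmetric E})
    (Z U : E) : B Z Z != 0 -> B Z (perp_part B Z U) = 0.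
Proof.
move=> Z0; rewrite linearBr linearZr_LR /= divfK //.
by rewrite (sym_formC B U) subrr.
Qed.

(** The orthogonal projections along [Z] span a subspace that misses [Z]; so
    when independent they stay independent after [Z] is added, which leaves
    them at least one dimension short of filling [P]. *)
Lemma size_free_perp_part (F : fieldType) (E : vectType F)
    (B : {symmetric E}) (P : {vspace E}) (Z : E) (s : seq E) :
  B Z Z != 0 -> Z \in P -> {subset s <= P} ->
  free [seq perp_part B Z X | X <- s] -> (size s < \dim P)%N.
Proof.
move=> Z0 ZP sP; set t := map _ s => free_t.
have Zt : Z \notin <<t>>%VS.
  apply: contraNN (Z0) => /(coord_span (X := in_tuple t)) eqZ.
  apply/eqP; rewrite {2}eqZ linear_sumr big1 // => i _; rewrite linearZr_LR /=.
  have /mapP[X _ ->] : t`_i \in t by rewrite mem_nth.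
  by rewrite perp_part_orth ?mulr0.
have : free (Z :: t) by rewrite free_cons Zt.
rewrite /free /= size_map => /eqP <-; apply/dimvS/span_subvP => X.
rewrite inE => /predU1P[-> //|/mapP[Y Ys ->]].
by rewrite /perp_part memvB ?memvZ //; exact: sP.
Qed.

(** The coefficients of a linear relation between the vectors form a kernel
    vector of the Gram matrix. *)
Lemma gram_det_eq0 (F : fieldType) (E : vectType F) (B : {symmetric E})
    n (X : n.-tuple E) :
  ~~ free X -> \det (\matrix_(i < n, j < n) B X`_i X`_j) = 0.
Proof.
apply: contraNeq => G0; apply/freeP => k kX i.
have k0 : \row_j k j == 0.
  apply: contraNT G0 => k0; apply/det0P; exists (\row_j k j) => //.
  apply/rowP => j; rewrite !mxE.
  transitivity (B (\sum_(l < n) k l *: X`_l) X`_j); last by rewrite kX linear0l.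
  by rewrite linear_sumlz; apply: eq_bigr => l _; rewrite !mxE linearZl_LR.
by have /rowP/(_ i) := eqP k0; rewrite !mxE.
Qed.

Lemma det_mx33 (R : comPzRingType) (M : 'M[R]_3) :
  \det M = M 0 0 * (M 1 1 * M 2 2 - M 1 2 * M 2 1)
         - M 0 1 * (M 1 0 * M 2 2 - M 1 2 * M 2 0)
         + M 0 2 * (M 1 0 * M 2 1 - M 1 1 * M 2 0).
Proof.
rewrite (expand_det_row M 0) !big_ord_recl big_ord0 /cofactor /=.
rewrite !(expand_det_row _ 0) !big_ord_recl !big_ord0 /cofactor !det_mx11.
rewrite !mxE /=.
(* Entries are read through natural numbers, so that the several forms of one
   index built by [lift] compute to the same numeral. *)
pose m i j := M (inord i) (inord j).
have mE i j : M i j = m i j by rewrite /m !inord_val.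
rewrite !{}mE /=; ring.
Qed.

(** The hypothesis is the vanishing of the determinant of the symmetric matrix
    with diagonal [a, b, c] and off-diagonal entries [x] (opposite [a]), [y]
    (opposite [b]) and [t] (opposite [c]). It is linear in the product
    [x * y * t], while the spreads only know the squares of [x], [y] and [t];
    isolating that product and squaring eliminates it. *)
Lemma triple_spread_gram (F : fieldType) (a b c x y t : F) :
  a != 0 -> b != 0 -> c != 0 ->
  a * b * c + 2%:R * x * y * t - a * x ^+ 2 - b * y ^+ 2 - c * t ^+ 2 = 0 ->
  let Ru := 1 - x ^+ 2 / (b * c) in
  let Rv := 1 - y ^+ 2 / (a * c) in
  let Rw := 1 - t ^+ 2 / (a * b) in
  (Ru + Rv + Rw) ^+ 2 =
    2%:R * (Ru ^+ 2 + Rv ^+ 2 + Rw ^+ 2) + 4%:R * Ru * Rv * Rw.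
Proof.
move=> a0 b0 c0 gram0 Ru Rv Rw.
have cosD : 2%:R - Ru - Rv - Rw = 2%:R * x * y * t / (a * b * c).
  apply/eqP; rewrite -subr_eq0; apply/eqP.
  transitivity (- (a * b * c + 2%:R * x * y * t - a * x ^+ 2 - b * y ^+ 2
                   - c * t ^+ 2) / (a * b * c)).
    by rewrite /Ru /Rv /Rw; field; rewrite a0 b0 c0.
  by rewrite gram0 oppr0 mul0r.
have cosM : (2%:R - Ru - Rv - Rw) ^+ 2 =
            4%:R * (1 - Ru) * (1 - Rv) * (1 - Rw).
  by rewrite cosD /Ru /Rv /Rw; field; rewrite a0 b0 c0.
apply/eqP; rewrite -subr_eq0; apply/eqP.
transitivity (4%:R * (1 - Ru) * (1 - Rv) * (1 - Rw)
              - (2%:R - Ru - Rv - Rw) ^+ 2); first by ring.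
by rewrite cosM subrr.
Qed.

Lemma vec_spread_someP (F : fieldType) (E : vectType F) (B : {symmetric E})
    (W U V : E) (R : F) :
  vec_spread B W U V = Some R ->
  let U' := perp_part B W U in let V' := perp_part B W V in
  [/\ B W W != 0, B U' U' != 0, B V' V' != 0
    & R = 1 - B U' V' ^+ 2 / (B U' U' * B V' V')].
Proof. by rewrite /vec_spread; case: ifP => // /and3P[? ? ?] [<-]. Qed.

Theorem theorem14 (F : fieldType) (char_not2 : 2%N \notin [pchar F])
    (E : vectType F) (B : {symmetric E}) (u v w z : {vspace E})
    (u_pt : proj_point u) (v_pt : proj_point v)
    (w_pt : proj_point w) (z_pt : proj_point z)
    (uvwz_coplanar : coplanar [:: u; v; w; z])
    (Ru Rv Rw : F)
    (def_Ru : spread B z v w = Some Ru)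
    (def_Rv : spread B z u w = Some Rv)
    (def_Rw : spread B z u v = Some Rw) :
  (Ru + Rv + Rw) ^+ 2 =
    2%:R * (Ru ^+ 2 + Rv ^+ 2 + Rw ^+ 2) + 4%:R * Ru * Rv * Rw.
Proof.
have [P dimP sP] := uvwz_coplanar.
have pickP x : x \in [:: u; v; w; z] -> vpick x \in P.
  by move=> /sP/subvP; apply; apply: memv_pick.
have [Z0 V0 W0 ->] := vec_spread_someP def_Ru.
have [_ U0 _ ->] := vec_spread_someP def_Rv.
have [_ _ _ ->] := vec_spread_someP def_Rw.
set U := perp_part B _ (vpick u) in U0 *.
set V := perp_part B _ (vpick v) in V0 *.
set W := perp_part B _ (vpick w) in W0 *.
apply: triple_spread_gram => //.
have dep : ~~ free [tuple U; V; W].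
  have ZP : vpick z \in P by rewrite pickP ?inE ?eqxx ?orbT.
  have sVP : {subset [seq vpick x | x <- [:: u; v; w]] <= P}.
    move=> X /mapP[x xuvw ->]; apply: pickP.
    by move: xuvw; rewrite !inE => /or3P[]->; rewrite ?orbT.
  by apply/negP => /(size_free_perp_part Z0 ZP sVP); rewrite dimP ltnn.
have := gram_det_eq0 B dep; rewrite det_mx33 !mxE /= => <-.
by rewrite (sym_formC B V U) (sym_formC B W U) (sym_formC B W V); ring.
Qed.
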